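(* Let $\phi=(\phi_{t,s})_{0\le s\le t\le T}$ be a stable almost flow on the Banach space $V$. Then, for $T$ small enough, there exists a unique Lipschitz flow $\psi$ in the galaxy containing $\phi$. Moreover, there is a constant $L\ge0$ such that for all $0\le s\le t\le T$, $$\|\psi_{t,s}-\phi_{t,s}\|_{\mathrm{Lip}}\le L\,\varpi(\omega_{s,t}).$$
   Context: Setting. $(V,|\cdot|)$ is a Banach space and $T>0$ a time horizon. For $f:V\to V$, $\|f\|_\infty=\sup_a|f(a)|$ and $\|f\|_{\mathrm{Lip}}=\sup_{a\ne b}|f(a)-f(b)|/|a-b|$. A control $\omega$ is a family of numbers $\omega_{s,t}\ge0$, $0\le s\le t\le T$, which is super-additive ($\omega_{r,s}+\omega_{s,t}\le\omega_{r,t}$ for $r\le s\le t$), continuous near the diagonal, with $\omega_{s,s}=0$. A remainder $\varpi:[0,\omega_{0,T}]\to\mathbb R_+$ is a continuous increasing function such that for some $0<\varkappa<1$, $2\varpi(\tau/2)\le\varkappa\varpi(\tau)$ for $\tau>0$. $\delta:\mathbb R_+\to\mathbb R_+$, $T'\mapsto\delta_{T'}$, is non-decreasing with $\lim_{T'\to0}\delta_{T'}=0$. ''For $T$ small enough'' means after replacing the horizon $T$ by a sufficiently small one and restricting all families to $[0,T]$. 4-points control. A function $f:V\to V$ satisfies a 4-points control if there are a non-decreasing continuous function $\widehat f:\mathbb R_+\to\mathbb R_+$ and a constant $f^\dagger\ge0$ such that for all $a,b,c,d\in V$, $$|f(a)-f(b)-f(c)+f(d)|\le\widehat f(|a-b|\vee|c-d|)\,(|a-c|\vee|b-d|)+f^\dagger|a-b-c+d|.$$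 Stable almost flow. A family of continuous maps $\phi_{t,s}:V\to V$, $0\le s\le t\le T$, is a stable almost flow if, with $\phi_{t,s,r}:=\phi_{t,s}\circ\phi_{s,r}-\phi_{t,r}$, there are such a $\delta$ and constants $M,C\ge0$ such that for every $T'\in(0,T]$ and all $0\le r\le s\le t\le T'$: (a) $\phi_{t,t}=\mathrm{id}$; $\|\phi_{t,s}-\mathrm{id}\|_\infty\le\delta_{T'}$; $\|\phi_{t,s}\|_{\mathrm{Lip}}\le1+\delta_{T'}$; $\|\phi_{t,s,r}\|_\infty\le M\varpi(\omega_{r,t})$; (b) each $\phi_{t,s}$ satisfies a 4-points control with some $\widehat\phi_{t,s}$ and $\phi^\dagger_{t,s}\le1+\delta_{T'}$, and it is $\varpi$-compatible: $\widehat\phi_{t,s}\le\widehat\phi_{v,u}$ whenever $[s,t]\subset[u,v]$, and $\widehat\phi_{t,s}(\alpha\varpi(\omega_{s,t}))\le\phi^{\circledast}(\alpha)\varpi(\omega_{s,t})$ for all $\alpha\ge0$, where $\phi^\circledast:\mathbb R_+\to\mathbb R_+$ is a function not depending on $(s,t)$; (c) $\|\phi_{t,s,r}\|_{\mathrm{Lip}}\le C\varpi(\omega_{r,t})$. Galaxy. Two families $\phi,\psi$ of continuous maps indexed by $0\le s\le t\le T$ are in the same galaxy if there is a constant $C'$ with $\|\phi_{t,s}-\psi_{t,s}\|_\infty\le C'\varpi(\omega_{s,t})$ for all $s\le t$. Flow. For a family $\psi=(\psi_{t,s})_{0\le s\le t\le T}$ of continuous maps $V\to V$, being a flow means $\psi_{t,t}=\mathrm{id}$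 and $\psi_{t,s}\circ\psi_{s,r}=\psi_{t,r}$ for all $r\le s\le t$. It is Lipschitz if the maps $\psi_{t,s}$ are Lipschitz with uniformly bounded Lipschitz constants. *)

(* Defs.v *)
From HB Require Import structures.
From mathcomp Require Import all_boot all_order all_algebra.
From mathcomp Require Import all_classical all_reals all_analysis.

Set Implicit Arguments.
Unset Strict Implicit.
Unset Printing Implicit Defensive.

Import Order.TTheory GRing.Theory Num.Theory.
Import numFieldNormedType.Exports.

Local Open Scope classical_set_scope.
Local Open Scope ring_scope.

(* A family (omega_{s,t}) is [omega s t], whereas a family of maps (phi_{t,s})
   is [phi t s], the later time first, as in the usual notation.  All families
   are total functions of real times; only their values for
   0 <= s <= t <= T are ever constrained. *)

Definition supnorm (R : realType) (V : normedModType R) (f : V -> V) : \bar R :=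
  ereal_sup [set `|f a|%:E | a in [set: V]].

(* The maximum with 0 only matters when V is trivial: the supremum is then
   taken over the empty set. *)
Definition lipnorm (R : realType) (V : normedModType R) (f : V -> V) : \bar R :=
  maxe 0%E (ereal_sup
    [set (`|f p.1 - f p.2| / `|p.1 - p.2|)%:E | p in [set p : V * V | p.1 != p.2]]).

Arguments supnorm {R V} f%_R.
Arguments lipnorm {R V} f%_R.

(* "Continuous near the diagonal": jointly continuous on a strip
   0 <= t - s < e of the triangle 0 <= s <= t <= T. *)
Definition control (R : realType) (T : R) (omega : R -> R -> R) : Prop :=
  [/\ forall s t : R, 0 <= s -> s <= t -> t <= T -> 0 <= omega s t,
      forall r s t : R, 0 <= r -> r <= s -> s <= t -> t <= T ->
        omega r s + omega s t <= omega r t,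
      exists2 e : R, 0 < e &
        {within [set p : R * R | [/\ 0 <= p.1, p.1 <= p.2, p.2 <= T
                                   & p.2 - p.1 < e]],
           continuous (fun p : R * R => omega p.1 p.2)}
    & forall s : R, 0 <= s -> s <= T -> omega s s = 0].

(* Remainder on [0, tau0].  The other conditions force varpi 0 = 0 as soon as
   0 < tau0; stating it explicitly only excludes the degenerate case
   tau0 = 0 < varpi 0, in which the condition on varpi (tau / 2) is void. *)
Definition remainder (R : realType) (tau0 : R) (varpi : R -> R) : Prop :=
  [/\ {within `[0, tau0], continuous varpi},
      {in `[0, tau0] &, {homo varpi : x y / x < y}},
      forall tau : R, 0 <= tau -> tau <= tau0 -> 0 <= varpi tau,
      exists kappa : R, [/\ 0 < kappa, kappa < 1 &
        forall tau : R, 0 < tau -> tau <= tau0 ->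
          2 * varpi (tau / 2) <= kappa * varpi tau]
    & varpi 0 = 0].

Definition modulus (R : realType) (delta : R -> R) : Prop :=
  [/\ forall x : R, 0 <= x -> 0 <= delta x,
      forall x y : R, 0 <= x -> x <= y -> delta x <= delta y
    & delta x @[x --> 0^'+] --> 0].

Definition four_points_control (R : realType) (V : normedModType R)
    (f : V -> V) (fhat : R -> R) (fdag : R) : Prop :=
  [/\ {within `[0, +oo[, continuous fhat},
      forall x y : R, 0 <= x -> x <= y -> fhat x <= fhat y,
      forall x : R, 0 <= x -> 0 <= fhat x,
      0 <= fdag
    & forall a b c d : V,
        `|f a - f b - f c + f d| <=
          fhat (Num.max `|a - b| `|c - d|) * Num.max `|a - c| `|b - d|
          + fdag * `|a - b - c + d|].

Definition flow_defect (R : realType) (V : normedModType R)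
    (phi : R -> R -> V -> V) (t s r : R) : V -> V :=
  (phi t s \o phi s r) \- phi t r.

Definition varpi_compatible (R : realType) (T : R) (omega : R -> R -> R)
    (varpi : R -> R) (phihat : R -> R -> R -> R) : Prop :=
  (forall u s t v : R, 0 <= u -> u <= s -> s <= t -> t <= v -> v <= T ->
     forall x : R, 0 <= x -> phihat t s x <= phihat v u x) /\
  (exists2 phicirc : R -> R, (forall alpha : R, 0 <= alpha -> 0 <= phicirc alpha) &
     forall s t : R, 0 <= s -> s <= t -> t <= T -> forall alpha : R, 0 <= alpha ->
       phihat t s (alpha * varpi (omega s t))
         <= phicirc alpha * varpi (omega s t)).

Definition stable_almost_flow (R : realType) (V : normedModType R) (T : R)
    (omega : R -> R -> R) (varpi : R -> R) (phi : R -> R -> V -> V) : Prop :=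
  (forall s t : R, 0 <= s -> s <= t -> t <= T -> continuous (phi t s)) /\
  exists (delta : R -> R) (M C : R)
         (phihat : R -> R -> R -> R) (phidag : R -> R -> R),
    [/\ modulus delta, 0 <= M, 0 <= C, varpi_compatible T omega varpi phihat &
      forall T' : R, 0 < T' -> T' <= T ->
      forall r s t : R, 0 <= r -> r <= s -> s <= t -> t <= T' ->
        [/\ [/\ phi t t = id,
                (supnorm (phi t s \- id) <= (delta T')%:E)%E,
                (lipnorm (phi t s) <= (1 + delta T')%:E)%E
              & (supnorm (flow_defect phi t s r)
                   <= (M * varpi (omega r t))%:E)%E],
            four_points_control (phi t s) (phihat t s) (phidag t s)
              /\ phidag t s <= 1 + delta T'
          & (lipnorm (flow_defect phi t s r)
               <= (C * varpi (omega r t))%:E)%E]].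

Definition same_galaxy (R : realType) (V : normedModType R) (T : R)
    (omega : R -> R -> R) (varpi : R -> R) (phi psi : R -> R -> V -> V) : Prop :=
  exists C' : R, forall s t : R, 0 <= s -> s <= t -> t <= T ->
    (supnorm (phi t s \- psi t s) <= (C' * varpi (omega s t))%:E)%E.

Definition flow (R : realType) (V : normedModType R) (T : R)
    (psi : R -> R -> V -> V) : Prop :=
  [/\ forall s t : R, 0 <= s -> s <= t -> t <= T -> continuous (psi t s),
      forall t : R, 0 <= t -> t <= T -> psi t t = id
    & forall r s t : R, 0 <= r -> r <= s -> s <= t -> t <= T ->
        psi t s \o psi s r = psi t r].

Definition lipschitz_flow (R : realType) (V : normedModType R) (T : R)
    (psi : R -> R -> V -> V) : Prop :=
  flow T psi /\
  exists K : R, forall s t : R, 0 <= s -> s <= t -> t <= T ->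
    (lipnorm (psi t s) <= K%:E)%E.

(* Main.v *)
Require Import Defs.
From mathcomp Require Import all_boot all_order all_algebra.
From mathcomp Require Import all_classical all_reals all_analysis.
From mathcomp Require Import ring lra.
Import Order.TTheory GRing.Theory Num.Theory.
Import numFieldNormedType.Exports.
Local Open Scope classical_set_scope.
Local Open Scope ring_scope.

Set Implicit Arguments.
Unset Strict Implicit.
Unset Printing Implicit Defensive.

(** Write w(s,t) for varpi(omega_{s,t}).  The flow psi is obtained by composing
    phi along finer and finer partitions of the time interval, and everything
    rests on estimates for such compositions that are uniform in the partition.

    Halving.  Continuity of omega and the intermediate value theorem give, for
    x <= y, a time m with omega_{x,m} = omega_{x,y} / 2; super-additivity then
    gives omega_{m,y} <= omega_{x,y} / 2, and the condition on the remainder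
    turns both bounds into w(x,m), w(m,y) <= (kappa/2) w(x,y).  This property,
    the monotonicity of w ([halving]) and the smallness of w(0,T) for small T are
    all that is used of omega and varpi.  Bisecting every interval of a
    partition multiplies the sum of w over its intervals by at most kappa < 1.

    Uniform estimates.  Let Phi be the composition of phi along a partition of
    [x,t].  By induction on the number of points, |Phi - phi_{t,x}| <= L w(x,t)
    ([chain_close]): one interval [u,y] of the partition contains the midpoint
    of [x,t], so the partitions of [x,u] and of [y,t] contribute
    at most L (kappa/2) w(x,t) each, up to Lipschitz constants close to 1, and
    reassembling the three pieces costs two defects of phi.  The kappa gained by
    halving makes the induction close for L large.  The same induction bounds
    the Lipschitz constant of Phi - phi_{t,x} by K w(x,t) ([chain_close_lip]);
    here the 4-points control is what propagates an estimate on a difference of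
    differences through the maps phi_{t,s}, and smallness of the horizon, in the
    form K w(0,T) <= eta, keeps the Lipschitz constant of Phi itself below 2
    whatever the partition ([chain_lip]).

    Existence.  The Lipschitz bound makes local errors add up: inserting
    midpoints in a partition changes the composition by at most 2 M times the
    sum of w over the partition, which decays geometrically along successive
    bisections.  The restrictions to [s,t] of the bisections of [0,T] therefore
    yield Cauchy sequences.  Gluing the restrictions to [r,s] and [s,t] differs
    from the restriction to [r,t] only on the interval that contains s, so the
    limit is a flow ([limit_flow]).  Both uniform estimates pass to the limit.

    Uniqueness.  Two Lipschitz flows that are w-close on each interval differ by
    a constant times the sum of w over an arbitrary partition, which can be made
    arbitrarily small ([flow_unique]). *)

(** * Sup norms and Lipschitz norms *)

Lemma norm_triangle3 (R : realType) (V : normedModType R) (a b c d : V) :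
  `|a - d| <= `|a - b| + (`|b - c| + `|c - d|).
Proof.
apply: le_trans (ler_distD b _ _) _; rewrite lerD2l; exact: ler_distD.
Qed.

Lemma sub_swap (V : zmodType) (a b c d : V) :
  (a - b) - (c - d) = (a - c) - (b - d).
Proof. by rewrite !opprB addrACA [- b - c]addrC addrACA. Qed.

Lemma sub_regroup (V : zmodType) (a b c d : V) :
  a - b - c + d = (a - c) - (b - d).
Proof. by rewrite opprB addrA addrAC [a - b - c]addrAC addrAC. Qed.

Lemma supnorm_leP (R : realType) (V : normedModType R) (f : V -> V) (c : R) :
  (supnorm f <= c%:E)%E <-> forall a, `|f a| <= c.
Proof.
split=> [/ereal_supP h a|h].
  by rewrite -lee_fin; apply: h; exists a.
by apply/ereal_supP => _ [a _ <-]; rewrite lee_fin.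
Qed.

Lemma lipnorm_leP (R : realType) (V : normedModType R) (f : V -> V) (c : R) :
  (lipnorm f <= c%:E)%E <->
  0 <= c /\ forall a b, `|f a - f b| <= c * `|a - b|.
Proof.
rewrite /lipnorm ge_max; split=> [/andP[c0 /ereal_supP h]|[c0 h]].
  split=> [|a b]; first by rewrite -lee_fin.
  have [->|ab] := eqVneq a b; first by rewrite !subrr normr0 mulr0.
  rewrite -ler_pdivrMr ?normr_gt0 ?subr_eq0 // -lee_fin.
  by apply: h; exists (a, b).
apply/andP; split; first by rewrite lee_fin.
apply/ereal_supP => _ [[a b] /= ab <-]; rewrite lee_fin.
by rewrite ler_pdivrMr ?normr_gt0 ?subr_eq0.
Qed.

Lemma lipschitz_continuous (R : realType) (V : normedModType R) (f : V -> V)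
    (c : R) :
  (forall a b, `|f a - f b| <= c * `|a - b|) -> continuous f.
Proof.
move=> h a; apply/cvgrPdist_lt => e e0.
have c0 : 0 < `|c| + 1 by rewrite ltr_wpDl.
near=> b.
apply: le_lt_trans (h a b) _.
apply: (@le_lt_trans _ _ ((`|c| + 1) * `|a - b|)).
  by rewrite ler_wpM2r // (le_trans (ler_norm _)) // lerDl.
rewrite -ltr_pdivlMl //; near: b; apply: cvgr_dist_lt => //.
by rewrite mulr_gt0 ?invr_gt0.
Unshelve. all: by end_near. Qed.

(** * Partitions of an interval and halving *)

Section HalvingFamilies.
Context {R : realType}.
Implicit Types (w : R -> R -> R) (s t x y z : R) (l : seq R).

(** The joint abstraction of a control and a remainder: w stands for
    varpi(omega_{s,t}).  The last clause is where continuity of the control and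
    the contraction property of the remainder come together. *)
Definition halving (T kappa : R) w : Prop :=
  [/\ forall s t, 0 <= s -> s <= t -> t <= T -> 0 <= w s t,
      forall u s t v, 0 <= u -> u <= s -> s <= t -> t <= v -> v <= T ->
        w s t <= w u v
    & forall x y, 0 <= x -> x <= y -> y <= T -> exists m,
        [/\ x <= m, m <= y, w x m <= kappa / 2 * w x y
          & w m y <= kappa / 2 * w x y]].

Fixpoint path_sum w x l : R :=
  if l is y :: l' then w x y + path_sum w y l' else 0.

Fixpoint bisect (mid : R -> R -> R) x l : seq R :=
  if l is y :: l' then mid x y :: y :: bisect mid y l' else [::].

(** Applying [clamp s t] to the points of a partition restricts it to [s,t]
    without changing the number of points: the intervals outside [s,t] become
    degenerate, where an almost flow is the identity. *)
Definition clamp s t x : R := Num.max s (Num.min t x).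

Lemma path_le_last x l : path <=%R x l -> x <= last x l.
Proof.
elim: l x => //= y l IH x /andP[xy /IH]; exact: le_trans.
Qed.

(** Some interval of a partition, here from [last x l1] to [y], contains any
    given time. *)
Lemma split_at_time m x l : l != [::] -> path <=%R x l -> x <= m ->
  m <= last x l ->
  exists l1 y l2, [/\ l = l1 ++ y :: l2, last x l1 <= m & m <= y].
Proof.
elim: l x => //= y l IH x _ /andP[xy pl] xm mlast.
have [my|ym] := leP m y; first by exists [::], y, l.
case: l IH pl mlast => [|z l] IH pl mlast; first by rewrite /= leNgt ym in mlast.
have [l1 [y' [l2 [-> h1 h2]]]] := IH y isT pl (ltW ym) mlast.
by exists (y :: l1), y', l2.
Qed.

Lemma clamp_mono s t x y : x <= y -> clamp s t x <= clamp s t y.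
Proof.
by rewrite /clamp /Num.max /Num.min => h; repeat case: ifP; lra.
Qed.

Lemma clamp_ge s t x : s <= clamp s t x.
Proof. by rewrite /clamp le_max lexx. Qed.

Lemma clamp_le s t x : s <= t -> clamp s t x <= t.
Proof. by move=> st; rewrite /clamp ge_max st ge_min lexx. Qed.

Lemma clamp_low s t x : s <= t -> x <= s -> clamp s t x = s.
Proof.
by move=> st xs; rewrite /clamp min_r ?max_l //; exact: le_trans st.
Qed.

Lemma clamp_high s t x : s <= t -> t <= x -> clamp s t x = t.
Proof. by move=> st tx; rewrite /clamp min_l // max_r. Qed.

(** A restricted interval is either degenerate or contained in the original
    one, so restricting a partition cannot increase its intervals. *)
Lemma clamp_shrink s t x y : s <= t -> x <= y ->
  clamp s t x = clamp s t y \/ (x <= clamp s t x /\ clamp s t y <= y).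
Proof.
rewrite /clamp /Num.max /Num.min => st xy.
by repeat case: ifP; move=> *; try lra; (left; lra) || (right; lra).
Qed.

Lemma clamp_path s t x l : path <=%R x l ->
  path <=%R (clamp s t x) [seq clamp s t z | z <- l].
Proof.
elim: l x => //= y l IH x /andP[xy /IH ->]; by rewrite clamp_mono.
Qed.

Section Theory.
Variables (T kappa : R) (w : R -> R -> R).
Hypotheses (kappa_ge0 : 0 <= kappa) (kappa_lt1 : kappa < 1).
Hypothesis w_halving : halving T kappa w.

Lemma halving_ge0 s t : 0 <= s -> s <= t -> t <= T -> 0 <= w s t.
Proof. by have [h _ _] := w_halving; exact: h. Qed.

Lemma halving_mono u s t v :
  0 <= u -> u <= s -> s <= t -> t <= v -> v <= T -> w s t <= w u v.
Proof. by have [_ h _] := w_halving; exact: h. Qed.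

Lemma halving_diag s : 0 <= s -> s <= T -> w s s = 0.
Proof.
move=> s0 sT; have [_ _ h] := w_halving.
have [m [sm ms h1 _]] := h s s s0 (lexx _) sT.
have ms_eq : m = s by apply/le_anti; rewrite ms sm.
rewrite ms_eq in h1; have w0 := halving_ge0 s0 (lexx s) sT.
apply/le_anti; rewrite w0 andbT.
have : 0 <= (1 - kappa) * w s s by rewrite mulr_ge0 // subr_ge0 ltW.
by lra.
Qed.

(** A discrete midpoint: if the interval [u,y] of the partition contains the
    midpoint m of [x,t], then [x,u] is contained in [x,m] and [y,t] in [m,t].
    Taking the interval rather than one of its ends is what
    makes both remaining pieces small for an arbitrary partition. *)
Lemma halving_split x l : l != [::] -> 0 <= x -> path <=%R x l ->
  last x l <= T ->
  exists l1 y l2, [/\ l = l1 ++ y :: l2,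
    w x (last x l1) <= kappa / 2 * w x (last x l)
    & w y (last x l) <= kappa / 2 * w x (last x l)].
Proof.
move=> l0 x0 pl lT; have [_ _ h] := w_halving.
have [m [xm ml h1 h2]] := h x (last x l) x0 (path_le_last pl) lT.
have [l1 [y [l2 [el l1m my]]]] := split_at_time l0 pl xm ml.
exists l1, y, l2; split=> //.
- apply: le_trans h1; apply: halving_mono => //; last exact: le_trans lT.
  by move: pl; rewrite el cat_path => /andP[/path_le_last].
- apply: le_trans h2; apply: halving_mono => //; first exact: le_trans xm.
  by move: pl; rewrite el cat_path last_cat /= => /andP[_ /andP[_ /path_le_last]].
Qed.

Lemma halving_clamp s t x y : 0 <= s -> s <= t -> t <= T ->
  0 <= x -> x <= y -> y <= T -> w (clamp s t x) (clamp s t y) <= w x y.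
Proof.
move=> s0 st tT x0 xy yT.
have [->|[h1 h2]] := clamp_shrink st xy.
  rewrite halving_diag ?halving_ge0 //.
    by apply: le_trans (clamp_ge _ _ _).
  by apply: le_trans (clamp_le _ st) _.
by apply: halving_mono => //; exact: clamp_mono.
Qed.

Lemma path_sum_ge0 x l : 0 <= x -> path <=%R x l -> last x l <= T ->
  0 <= path_sum w x l.
Proof.
elim: l x => //= y l IH x x0 /andP[xy pl] lT.
rewrite addr_ge0 ?IH ?halving_ge0 //; first by rewrite (le_trans _ lT) ?path_le_last.
exact: le_trans xy.
Qed.

Lemma halving_midpoint : exists mid : R -> R -> R, forall x y,
  0 <= x -> x <= y -> y <= T ->
  [/\ x <= mid x y, mid x y <= y, w x (mid x y) <= kappa / 2 * w x y
    & w (mid x y) y <= kappa / 2 * w x y].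
Proof.
have [_ _ h] := w_halving.
pose P (p : R * R) (m : R) := 0 <= p.1 -> p.1 <= p.2 -> p.2 <= T ->
  [/\ p.1 <= m, m <= p.2, w p.1 m <= kappa / 2 * w p.1 p.2
    & w m p.2 <= kappa / 2 * w p.1 p.2].
have /boolp.choice [f fP] : forall p, exists m, P p m.
  move=> [x y]; rewrite /P /=.
  have [[[x0 xy] yT]|nH] := pselect ((0 <= x /\ x <= y) /\ y <= T).
    by have [m hm] := h x y x0 xy yT; exists m.
  by exists 0 => x0 xy yT; exfalso; apply: nH.
by exists (fun x y => f (x, y)) => x y x0 xy yT; exact: (fP (x, y)).
Qed.

Section Bisection.
Variable mid : R -> R -> R.
Hypothesis midP : forall x y, 0 <= x -> x <= y -> y <= T ->
  [/\ x <= mid x y, mid x y <= y, w x (mid x y) <= kappa / 2 * w x y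
    & w (mid x y) y <= kappa / 2 * w x y].

Lemma bisect_path x l : 0 <= x -> path <=%R x l -> last x l <= T ->
  [/\ path <=%R x (bisect mid x l), last x (bisect mid x l) = last x l
    & path_sum w x (bisect mid x l) <= kappa * path_sum w x l].
Proof.
elim: l x => [|y l IH] x x0 /=; first by move=> _ _; rewrite mulr0.
move=> /andP[xy pl] lT.
have yT : y <= T by rewrite (le_trans _ lT) ?path_le_last.
have [p1 -> s1] := IH y (le_trans x0 xy) pl lT.
have [-> -> m1 m2] := midP x0 xy yT.
by rewrite p1; split=> //; lra.
Qed.

Lemma iter_bisect n x y : 0 <= x -> x <= y -> y <= T ->
  let l := iter n (bisect mid x) [:: y] in
  [/\ path <=%R x l, last x l = y & path_sum w x l <= kappa ^+ n * w x y].
Proof.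
move=> x0 xy yT; elim: n => [|n] /=; first by rewrite xy expr0 mul1r addr0.
move=> [pl el sl]; have [|-> -> ss] := bisect_path x0 pl; first by rewrite el.
split=> //; apply: le_trans ss _.
by rewrite exprS -mulrA ler_wpM2l.
Qed.

End Bisection.
End Theory.
End HalvingFamilies.

(** * Compositions of an almost flow along partitions *)

Section Chains.
Context {R : realType} {V : normedModType R}.
Implicit Types (phi : R -> R -> V -> V) (s t x y z : R) (l : seq R) (a b : V).

Fixpoint chain phi x l : V -> V :=
  if l is y :: l' then chain phi y l' \o phi y x else id.

Lemma chain_cat phi x l1 y l2 a :
  chain phi x (l1 ++ y :: l2) a =
  chain phi y l2 (phi y (last x l1) (chain phi x l1 a)).
Proof. by elim: l1 x a => //= z l1 IH x a; rewrite IH. Qed.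

(* The next two inequalities say that the Lipschitz constants 1 + eta of phi and
   1 + 2 eta of a composition along a partition leave a contraction factor
   q < 1 out of the factor kappa gained by halving. *)

Lemma kappa_lip2 (kappa eta q : R) : 0 <= kappa -> 0 <= eta ->
  kappa * (1 + 2 * eta) ^+ 2 <= q -> kappa / 2 * (1 + (1 + eta) ^+ 2) <= q.
Proof.
move=> k0 e0; apply: le_trans; rewrite -mulrA ler_wpM2l //.
by have := mulr_ge0 e0 e0; lra.
Qed.

Lemma kappa_lip3 (kappa eta q : R) : 0 <= kappa -> 0 <= eta ->
  kappa * (1 + 2 * eta) ^+ 2 <= q ->
  kappa / 2 * ((1 + eta) * (1 + 2 * eta) + (1 + eta) ^+ 2) <= q.
Proof.
move=> k0 e0; apply: le_trans; rewrite -mulrA ler_wpM2l //.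
by have := mulr_ge0 e0 e0; lra.
Qed.

(** The constants are tied as follows: q is the contraction factor of both
    inductions on partitions, L absorbs the two defects (2 M) of the first one,
    and K absorbs the 4-points terms (4 P) and the Lipschitz constants of the
    defects (3 C) of the second one. *)
Variables (T kappa eta q M C L P K : R) (w : R -> R -> R) (phi : R -> R -> V -> V).
Hypotheses (kappa_ge0 : 0 <= kappa) (kappa_lt1 : kappa < 1) (eta_ge0 : 0 <= eta).
Hypotheses (M_ge0 : 0 <= M) (C_ge0 : 0 <= C) (L_ge0 : 0 <= L) (P_ge0 : 0 <= P)
  (K_ge0 : 0 <= K).
Hypothesis eta_small : eta <= 1 / 16.
Hypothesis kappa_eta : kappa * (1 + 2 * eta) ^+ 2 <= q.
Hypothesis L_large : q * L + 2 * M <= L.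
Hypothesis K_large : q * K + (4 * P + 3 * C) <= K.
Hypothesis w_halving : halving T kappa w.
Hypothesis Kw_small : K * w 0 T <= eta.
Hypothesis phi_id : forall t, 0 <= t -> t <= T -> phi t t = id.
Hypothesis phi_lip : forall s t, 0 <= s -> s <= t -> t <= T -> forall a b,
  `|phi t s a - phi t s b| <= (1 + eta) * `|a - b|.
Hypothesis phi_defect : forall r s t, 0 <= r -> r <= s -> s <= t -> t <= T ->
  forall a, `|phi t s (phi s r a) - phi t r a| <= M * w r t.
Hypothesis phi_defect_lip : forall r s t,
  0 <= r -> r <= s -> s <= t -> t <= T -> forall a b,
  `|(phi t s (phi s r a) - phi t s (phi s r b)) - (phi t r a - phi t r b)|
    <= C * w r t * `|a - b|.
Hypothesis phi_four_points : forall u s t v,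
  0 <= u -> u <= s -> s <= t -> t <= v -> v <= T -> forall a b c d e,
  `|a - b| <= 2 * L * w u v -> `|c - d| <= 2 * L * w u v ->
  `|a - c| <= e -> `|b - d| <= e ->
  `|(phi t s a - phi t s c) - (phi t s b - phi t s d)| <=
    P * w u v * e + (1 + eta) * `|(a - c) - (b - d)|.

Let w_ge0 := halving_ge0 w_halving.
Let w_mono := halving_mono w_halving.

(** Non-linear sewing estimate, uniform in the partition.  With the interval
    [u,y] of [halving_split], the composition is compared with
    phi_{t,y} phi_{y,u} phi_{u,x}, which is two defects away from phi_{t,x}. *)
Lemma chain_close l x a : 0 <= x -> path <=%R x l -> last x l <= T ->
  `|chain phi x l a - phi (last x l) x a| <= L * w x (last x l).
Proof.
have [n] := ubnP (size l); elim: n => // n IH in l x a * => szl x0 pl lT.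
have xt := path_le_last pl.
have [l0|l0] := eqVneq l [::].
  rewrite l0 /= in xt lT *; rewrite phi_id // subrr normr0.
  by rewrite mulr_ge0 ?w_ge0.
have [l1 [y [l2 [el w1 w2]]]] := halving_split w_halving l0 x0 pl lT.
set t := last x l in lT xt w1 w2 *.
have et : last y l2 = t by rewrite /t el last_cat.
move: pl; rewrite el cat_path /= => /and3P[pl1 uy pl2].
set u := last x l1 in uy w1 *.
have xu : x <= u := path_le_last pl1.
have yt : y <= t by rewrite -et path_le_last.
have sz : (size l1 + size l2 < n)%N by move: szl; rewrite el size_cat addnS ltnS.
have sz1 := leq_ltn_trans (leq_addr _ _) sz.
have sz2 := leq_ltn_trans (leq_addl _ _) sz.
have u0 : 0 <= u := le_trans x0 xu.
have y0 : 0 <= y := le_trans u0 uy.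
have yT := le_trans yt lT; have uT := le_trans uy yT.
have IH1 := IH l1 x a sz1 x0 pl1 uT.
rewrite chain_cat -/u in IH1 *; set b := chain phi x l1 a in IH1 *.
have := IH l2 y (phi y u b) sz2 y0 pl2; rewrite et => /(_ lT) IH2.
have wut : w u t <= w x t by apply: w_mono => //; exact: le_trans yt.
have wxt := w_ge0 x0 xt lT.
pose X := L * (kappa / 2 * w x t).
have B1 : `|b - phi u x a| <= X by apply: le_trans IH1 _; rewrite ler_wpM2l.
have B2 : `|chain phi y l2 (phi y u b) - phi t y (phi y u b)| <= X.
  by apply: le_trans IH2 _; rewrite ler_wpM2l.
have B3 : `|phi t y (phi y u b) - phi t y (phi y u (phi u x a))|
    <= (1 + eta) ^+ 2 * X.
  rewrite expr2 -mulrA.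
  apply: le_trans (phi_lip y0 yt lT _ _) _; rewrite ler_wpM2l ?addr_ge0 //.
  apply: le_trans (phi_lip u0 uy yT _ _) _; rewrite ler_wpM2l ?addr_ge0 //.
have D1 : `|phi t y (phi y u (phi u x a)) - phi t u (phi u x a)| <= M * w x t.
  by apply: le_trans (phi_defect u0 uy yt lT _) _; rewrite ler_wpM2l.
have D2 := phi_defect x0 xu (le_trans uy yt) lT a.
apply: le_trans (norm_triangle3 _ (phi t y (phi y u b))
  (phi t y (phi y u (phi u x a))) _) _.
have D := ler_distD (phi t u (phi u x a)) (phi t y (phi y u (phi u x a))) (phi t x a).
have H1 := ler_wpM2r (mulr_ge0 L_ge0 wxt) (kappa_lip2 kappa_ge0 eta_ge0 kappa_eta).
have H2 := ler_wpM2r wxt L_large.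
rewrite /X in B1 B2 B3; lra.
Qed.

(** The same comparison for differences of two trajectories.  The new difficulty
    is to pass from time u to time t through phi_{y,u} and phi_{t,y}, where
    Lipschitz bounds give only one of the factors w(x,t) and |a - b|.  The
    4-points control gives their product, since [chain_close] bounds the
    distances between the composed and the direct trajectories by L w(x,t). *)
Lemma chain_close_lip l x a b : 0 <= x -> path <=%R x l -> last x l <= T ->
  `|(chain phi x l a - chain phi x l b)
      - (phi (last x l) x a - phi (last x l) x b)|
    <= K * w x (last x l) * `|a - b|.
Proof.
have [n] := ubnP (size l); elim: n => // n IH in l x a b * => szl x0 pl lT.
have xt := path_le_last pl.
have [l0|l0] := eqVneq l [::].
  rewrite l0 /= in xt lT *; rewrite phi_id // subrr normr0.
  by rewrite !mulr_ge0 ?w_ge0.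
have [l1 [y [l2 [el w1 w2]]]] := halving_split w_halving l0 x0 pl lT.
set t := last x l in lT xt w1 w2 *.
have et : last y l2 = t by rewrite /t el last_cat.
move: pl; rewrite el cat_path /= => /and3P[pl1 uy pl2].
set u := last x l1 in uy w1 *.
have xu : x <= u := path_le_last pl1.
have yt : y <= t by rewrite -et path_le_last.
have sz : (size l1 + size l2 < n)%N by move: szl; rewrite el size_cat addnS ltnS.
have sz1 := leq_ltn_trans (leq_addr _ _) sz.
have sz2 := leq_ltn_trans (leq_addl _ _) sz.
have u0 : 0 <= u := le_trans x0 xu.
have y0 : 0 <= y := le_trans u0 uy.
have yT := le_trans yt lT; have uT := le_trans uy yT.
have ut := le_trans uy yt.
have IH1 := IH l1 x a b sz1 x0 pl1 uT.
have close c := chain_close c x0 pl1 uT.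
rewrite !chain_cat -/u in IH1 close *.
set a1 := chain phi x l1 a in IH1 *; set b1 := chain phi x l1 b in IH1 *.
have := IH l2 y (phi y u a1) (phi y u b1) sz2 y0 pl2; rewrite et => /(_ lT) IH2.
have wut : w u t <= w x t by apply: w_mono => //; exact: le_trans yt.
have wxu : w x u <= w x t by apply: w_mono.
have wxt := w_ge0 x0 xt lT.
have wx0 : K * w x u <= eta.
  by apply: le_trans Kw_small; rewrite ler_wpM2l // w_mono.
have N0 := normr_ge0 (a - b).
have [e0 e1] := (eta_ge0, eta_small).
set N := `|a - b| in IH1 N0 *; set W := w x t in w1 w2 wut wxu wxt *.
have lip_ab := phi_lip x0 xu uT a b.
(* Bounds between the two trajectories and between the composed and the direct
   maps at time u, then at time y: they are the hypotheses of the two uses of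
   the 4-points control. *)
have gap1 : `|a1 - b1| <= (1 + 2 * eta) * N.
  have := ler_wpM2r N0 wx0; move: IH1 lip_ab (ler_distD (phi u x a - phi u x b) (a1 - b1) 0).
  by rewrite !subr0 -/N; lra.
have gap2 : `|phi u x a - phi u x b| <= (1 + 2 * eta) * N.
  by apply: le_trans lip_ab _; rewrite ler_wpM2r //; lra.
have close_u c : `|chain phi x l1 c - phi u x c| <= 2 * L * W.
  apply: le_trans (close c) _; have := ler_wpM2l L_ge0 wxu.
  by have := mulr_ge0 L_ge0 wxt; lra.
have close_y c : `|phi y u (chain phi x l1 c) - phi y u (phi u x c)| <= 2 * L * W.
  apply: le_trans (phi_lip u0 uy yT _ _) _.
  apply: (@le_trans _ _ (2 * (L * W))); last by rewrite mulrA.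
  apply: ler_pM; rewrite ?normr_ge0 ?addr_ge0 //; first by lra.
  by apply: le_trans (close c) _; rewrite ler_wpM2l.
have lip1 c d r : `|c - d| <= r -> `|phi y u c - phi y u d| <= (1 + eta) * r.
  by move=> h; apply: le_trans (phi_lip u0 uy yT _ _) _; rewrite ler_wpM2l ?addr_ge0.
have Q1 := phi_four_points x0 xu uy yt lT (close_u a) (close_u b) gap1 gap2.
have Q2 := phi_four_points x0 (le_trans xu uy) yt (lexx t) lT (close_y a) (close_y b)
  (lip1 _ _ _ gap1) (lip1 _ _ _ gap2).
rewrite -/a1 -/b1 -/W in Q1 Q2.
have r1 : `|(a1 - b1) - (phi u x a - phi u x b)| <= K * (kappa / 2 * W) * N.
  by apply: le_trans IH1 _; rewrite ler_wpM2r // ler_wpM2l.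
have B1 : `|(chain phi y l2 (phi y u a1) - chain phi y l2 (phi y u b1)) -
    (phi t y (phi y u a1) - phi t y (phi y u b1))|
    <= K * (kappa / 2 * W) * ((1 + eta) * ((1 + 2 * eta) * N)).
  apply: le_trans IH2 _; apply: ler_pM; rewrite ?normr_ge0 ?mulr_ge0 ?w_ge0 //.
    by rewrite ler_wpM2l.
  exact: lip1.
have D1 : `|(phi t y (phi y u (phi u x a)) - phi t y (phi y u (phi u x b)))
    - (phi t u (phi u x a) - phi t u (phi u x b))| <= C * W * ((1 + eta) * N).
  apply: le_trans (phi_defect_lip u0 uy yt lT _ _) _.
  apply: ler_pM; rewrite ?normr_ge0 ?mulr_ge0 ?w_ge0 //.
  by rewrite ler_wpM2l.
have D2 := phi_defect_lip x0 xu ut lT a b; rewrite -/N -/W in D2.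
apply: le_trans (norm_triangle3 _ (phi t y (phi y u a1) - phi t y (phi y u b1))
  (phi t y (phi y u (phi u x a)) - phi t y (phi y u (phi u x b))) _) _.
have D := ler_distD (phi t u (phi u x a) - phi t u (phi u x b))
  (phi t y (phi y u (phi u x a)) - phi t y (phi y u (phi u x b)))
  (phi t x a - phi t x b).
have eta1 : 0 <= 1 + eta by rewrite addr_ge0.
have Q1' := ler_wpM2l eta1 Q1.
have r1' := ler_wpM2l (mulr_ge0 eta1 eta1) r1.
have WN := mulr_ge0 wxt N0.
have H1 := ler_wpM2r (mulr_ge0 K_ge0 WN) (kappa_lip3 kappa_ge0 eta_ge0 kappa_eta).
have H2 := ler_wpM2r WN K_large.
have H3 : 2 * (1 + eta) * (1 + 2 * eta) * (P * (W * N)) <= 4 * (P * (W * N)).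
  rewrite ler_wpM2r ?mulr_ge0 //.
  have := ler_wpM2l eta_ge0 eta_small; lra.
have H4 : (2 + eta) * (C * (W * N)) <= 3 * (C * (W * N)).
  by rewrite ler_wpM2r ?mulr_ge0 //; lra.
lra.
Qed.

(** This bound, uniform in the partition, is what lets local errors be summed. *)
Lemma chain_lip l x a b : 0 <= x -> path <=%R x l -> last x l <= T ->
  `|chain phi x l a - chain phi x l b| <= 2 * `|a - b|.
Proof.
move=> x0 pl lT; have xt := path_le_last pl.
have e0 := eta_ge0; have h1 := chain_close_lip a b x0 pl lT.
have h2 := phi_lip x0 xt lT a b.
have h3 := ler_distD (phi (last x l) x a - phi (last x l) x b)
  (chain phi x l a - chain phi x l b) 0.
have h4 : K * w x (last x l) <= eta.
  by apply: le_trans Kw_small; rewrite ler_wpM2l // w_mono.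
have h5 := ler_wpM2r (normr_ge0 (a - b)) h4.
have h6 := ler_wpM2r (normr_ge0 (a - b)) eta_small.
rewrite !subr0 in h3; have := normr_ge0 (a - b); lra.
Qed.

Definition clamped_chain s t x l :=
  chain phi (clamp s t x) [seq clamp s t z | z <- l].

Lemma clamped_lip s t x l a b : 0 <= s -> s <= t -> t <= T -> path <=%R x l ->
  `|clamped_chain s t x l a - clamped_chain s t x l b| <= 2 * `|a - b|.
Proof.
move=> s0 st tT pl; apply: chain_lip; rewrite ?clamp_path //.
- exact: le_trans (clamp_ge _ _ _).
- by rewrite last_map (le_trans _ tT) // clamp_le.
Qed.

Lemma clamped_after s t x l : s <= t -> t <= T -> 0 <= s -> t <= x ->
  path <=%R x l -> clamped_chain s t x l = id.
Proof.
move=> st tT s0; rewrite /clamped_chain.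
elim: l x => //= y l IH x tx /andP[xy pl].
rewrite !clamp_high ?(le_trans tx xy) // phi_id ?(le_trans s0 st) //.
by move: (IH y (le_trans tx xy) pl); rewrite clamp_high // (le_trans tx xy).
Qed.

Lemma clamped_defect s t x y z a : 0 <= s -> s <= t -> t <= T ->
  0 <= x -> x <= z -> z <= y -> y <= T ->
  `|phi (clamp s t y) (clamp s t z) (phi (clamp s t z) (clamp s t x) a)
      - phi (clamp s t y) (clamp s t x) a| <= M * w x y.
Proof.
move=> s0 st tT x0 xz zy yT.
apply: le_trans (phi_defect _ _ _ _ _) _; rewrite ?clamp_mono //.
- exact: le_trans (clamp_ge _ _ _).
- by apply: le_trans tT; exact: clamp_le.
- by rewrite ler_wpM2l ?(halving_clamp kappa_lt1 w_halving) // (le_trans xz).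
Qed.

Section Refinement.
Variable mid : R -> R -> R.
Hypothesis midP : forall x y, 0 <= x -> x <= y -> y <= T ->
  [/\ x <= mid x y, mid x y <= y, w x (mid x y) <= kappa / 2 * w x y
    & w (mid x y) y <= kappa / 2 * w x y].

(** Each inserted midpoint costs one defect, at most M w on its interval; the
    rest of the composition at most doubles it. *)
Lemma clamped_bisect s t x l a : 0 <= s -> s <= t -> t <= T ->
  0 <= x -> path <=%R x l -> last x l <= T ->
  `|clamped_chain s t x (bisect mid x l) a - clamped_chain s t x l a|
    <= 2 * M * path_sum w x l.
Proof.
move=> s0 st tT; rewrite /clamped_chain.
elim: l x a => [|y l IH] x a x0 /=; first by rewrite subrr normr0 mulr0.
move=> /andP[xy pl] lT; have yT : y <= T := le_trans (path_le_last pl) lT.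
have [xm my _ _] := midP x0 xy yT.
apply: le_trans (ler_distD (clamped_chain s t y l
  (phi (clamp s t y) (clamp s t (mid x y))
    (phi (clamp s t (mid x y)) (clamp s t x) a))) _ _) _.
rewrite mulrDr addrC lerD //; last by apply: IH => //; exact: le_trans xy.
apply: le_trans (clamped_lip _ _ s0 st tT pl) _.
by rewrite -mulrA ler_wpM2l // clamped_defect.
Qed.

End Refinement.

(** The two sides apply the same maps except on the interval that contains s,
    where they differ by one defect.  The bound by the whole sum is crude but
    tends to 0 along bisections. *)
Lemma clamped_glue r s t x l a : 0 <= r -> r <= s -> s <= t -> t <= T ->
  0 <= x -> x <= s -> path <=%R x l -> last x l <= T ->
  `|clamped_chain s t x l (clamped_chain r s x l a) - clamped_chain r t x l a|
    <= 2 * M * path_sum w x l.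
Proof.
move=> r0 rs st tT; have rt := le_trans rs st; have s0 := le_trans r0 rs.
have sT := le_trans st tT.
elim: l x a => [|y l IH] x a x0 xs; first by rewrite /= subrr normr0 mulr0.
move=> pxl lT; have /andP[xy pl] := pxl.
have yT : y <= T := le_trans (path_le_last pl) lT.
have y0 := le_trans x0 xy.
have w0 : 0 <= w x y := w_ge0 x0 xy yT.
have S0 := path_sum_ge0 w_halving y0 pl lT.
rewrite /clamped_chain /= -!/(clamped_chain _ _ y l).
have [ys|sy] := leP y s.
  rewrite !(clamp_low st) // phi_id //=.
  have clampE z : z <= s -> clamp r s z = clamp r t z.
    by move=> zs; rewrite /clamp !min_r // (le_trans zs st).
  rewrite -(clampE x) // -(clampE y) //.
  apply: le_trans (IH y _ y0 ys pl lT) _.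
  by rewrite ler_wpM2l ?mulr_ge0 // lerDr.
have sy' := ltW sy.
rewrite (clamped_after rs sT r0 sy' pl) /=.
have clampE z : s <= z -> clamp s t z = clamp r t z.
  move=> sz; rewrite /clamp !max_r // le_min ?st ?rt //=.
  exact: le_trans sz.
have -> : clamped_chain s t y l = clamped_chain r t y l.
  rewrite /clamped_chain clampE //; congr (chain _ _ _).
  apply/eq_in_map => z zl; apply: clampE; apply: le_trans sy' _.
  by have /allP -> := order_path_min le_trans pl.
apply: le_trans (clamped_lip _ _ r0 rt tT pl) _.
rewrite -mulrA ler_wpM2l //.
have cs : clamp r t s = s by rewrite /clamp min_r // max_r.
rewrite (clamp_high rs sy') (clamp_low st xs) (clampE y sy').
have -> : clamp r s x = clamp r t x.
  by rewrite /clamp !min_r // (le_trans xs st).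
rewrite -[in X in `|X|]cs.
apply: le_trans (clamped_defect _ r0 rt tT x0 xs sy' yT) _.
by rewrite ler_wpM2l // lerDl.
Qed.

(** The maps [U n] are the compositions along the n-th bisection of [0,T],
    restricted to each subinterval. *)
Lemma approximate_flows : 0 <= T -> exists U : nat -> R -> R -> V -> V,
  forall n,
  [/\ forall t, 0 <= t -> t <= T -> U n t t = id,
      forall s t a, 0 <= s -> s <= t -> t <= T ->
        `|U n.+1 t s a - U n t s a| <= 2 * M * (kappa ^+ n * w 0 T),
      forall r s t a, 0 <= r -> r <= s -> s <= t -> t <= T ->
        `|U n t s (U n s r a) - U n t r a| <= 2 * M * (kappa ^+ n * w 0 T),
      forall s t a, 0 <= s -> s <= t -> t <= T ->
        `|U n t s a - phi t s a| <= L * w s t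
    & forall s t a b, 0 <= s -> s <= t -> t <= T ->
        `|U n t s a - U n t s b| <= 2 * `|a - b| /\
        `|(U n t s a - U n t s b) - (phi t s a - phi t s b)|
          <= K * w s t * `|a - b|].
Proof.
move=> T0; have [mid midP] := halving_midpoint w_halving.
pose l n := iter n (bisect mid 0) [:: T].
have lP n : [/\ path <=%R 0 (l n), last 0 (l n) = T
  & path_sum w 0 (l n) <= kappa ^+ n * w 0 T].
  exact: (iter_bisect kappa_ge0 midP n (lexx 0) T0 (lexx T)).
exists (fun n t s => clamped_chain s t 0 (l n)) => n.
have [pl el sl] := lP n; have lT : last 0 (l n) <= T by rewrite el.
have M20 : 0 <= 2 * M by rewrite mulr_ge0.
have start s t : 0 <= s -> s <= t -> clamp s t 0 = s.
  by move=> s0 st; rewrite clamp_low.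
have clampedE s t : 0 <= s -> s <= t -> t <= T ->
    [/\ clamped_chain s t 0 (l n) = chain phi s [seq clamp s t z | z <- l n],
        path <=%R s [seq clamp s t z | z <- l n]
      & last s [seq clamp s t z | z <- l n] = t].
  move=> s0 st tT; have s_eq := start s t s0 st.
  have := last_map (clamp s t) (l n) 0; have := clamp_path s t pl.
  by rewrite /clamped_chain s_eq el clamp_high.
split.
- move=> t t0 tT; rewrite /clamped_chain.
  have clampE z : clamp t t z = t by apply/le_anti; rewrite clamp_le ?clamp_ge.
  rewrite clampE; elim: (l n) => //= y m IH; by rewrite clampE IH phi_id.
- move=> s t a s0 st tT; apply: le_trans (clamped_bisect midP a s0 st tT _ pl lT) _ => //.
  by rewrite ler_wpM2l.
- move=> r s t a r0 rs st tT.
  apply: le_trans (clamped_glue a r0 rs st tT _ _ pl lT) _ => //; last by rewrite ler_wpM2l.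
  exact: le_trans rs.
- move=> s t a s0 st tT; have [-> pc lc] := clampedE s t s0 st tT.
  by have := chain_close a s0 pc; rewrite lc; exact.
- move=> s t a b s0 st tT; split; first exact: clamped_lip.
  have [-> pc lc] := clampedE s t s0 st tT.
  by have := chain_close_lip a b s0 pc; rewrite lc; exact.
Qed.

End Chains.

(** * Limits of approximate flows *)

Section Limits.
Context {R : realType}.

Lemma cvg_norm_le (V : normedModType R) (u : nat -> V) (l : V) (c : R) :
  u n @[n --> \oo] --> l -> (forall n, `|u n| <= c) -> `|l| <= c.
Proof.
move=> ul uc; have nl : `|u n| @[n --> \oo] --> `|l| by exact: cvg_norm.
rewrite -(cvg_lim _ nl) //; apply: limr_le; first by apply/cvg_ex; exists `|l|.
exact: nearW.
Qed.

Lemma geometric_cvg (V : completeNormedModType R) (u : nat -> V) (c k : R) :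
  0 <= k -> k < 1 -> (forall n, `|u n.+1 - u n| <= c * k ^+ n) ->
  cvgn u.
Proof.
move=> k0 k1 hu.
have c0 : 0 <= c by have := hu 0%N; rewrite expr0 mulr1; exact: le_trans.
have : cvgn (series (telescope u)).
  apply: normed_cvg; apply: (series_le_cvg _ _ hu) => [n|n|].
  - exact: normr_ge0.
  - by rewrite mulr_ge0 ?exprn_ge0.
  - by apply: is_cvg_geometric_series; rewrite ger0_norm.
rewrite telescopeK => h.
have -> : u = (fun n => (u n - u 0%N) + u 0%N) by apply/funext => n; rewrite subrK.
apply: is_cvgD => //; exact: is_cvg_cst.
Qed.

Lemma geometric_cvg0 (c k : R) : 0 <= k -> k < 1 -> c * k ^+ n @[n --> \oo] --> 0.
Proof.
by move=> k0 k1; apply: cvg_geometric; rewrite ger0_norm.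
Qed.

Lemma geometric_le0 (x c k : R) : 0 <= k -> k < 1 ->
  (forall n, x <= c * k ^+ n) -> x <= 0.
Proof.
move=> k0 k1 h; have g := geometric_cvg0 c k0 k1.
rewrite -(cvg_lim _ g) //; apply: limr_ge; first by apply/cvg_ex; exists 0.
exact: nearW.
Qed.

(** The Lipschitz bound uniform in n is what identifies the limit of
    the compositions U n t s (U n s r a), where both factors vary with n. *)
Lemma limit_flow (V : completeNormedModType R) (T c k : R)
    (U : nat -> R -> R -> V -> V) : 0 <= k -> k < 1 ->
  (forall n t, 0 <= t -> t <= T -> U n t t = id) ->
  (forall n s t a b, 0 <= s -> s <= t -> t <= T ->
     `|U n t s a - U n t s b| <= 2 * `|a - b|) ->
  (forall n s t a, 0 <= s -> s <= t -> t <= T ->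
     `|U n.+1 t s a - U n t s a| <= c * k ^+ n) ->
  (forall n r s t a, 0 <= r -> r <= s -> s <= t -> t <= T ->
     `|U n t s (U n s r a) - U n t r a| <= c * k ^+ n) ->
  exists psi : R -> R -> V -> V,
  [/\ forall s t a, 0 <= s -> s <= t -> t <= T ->
        U n t s a @[n --> \oo] --> psi t s a,
      forall t, 0 <= t -> t <= T -> psi t t = id
    & forall r s t, 0 <= r -> r <= s -> s <= t -> t <= T ->
        psi t s \o psi s r = psi t r].
Proof.
move=> k0 k1 U_id U_lip U_cauchy U_glue.
pose psi t s a : V := limn (fun n => U n t s a).
have psiP s t a : 0 <= s -> s <= t -> t <= T ->
    U n t s a @[n --> \oo] --> psi t s a.
  move=> s0 st tT; apply: (geometric_cvg k0 k1) => n; exact: U_cauchy.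
exists psi; split=> //.
  move=> t t0 tT; apply/funext => a.
  have := psiP t t a t0 (lexx t) tT.
  under eq_fun do rewrite U_id //.
  by move=> /(cvg_unique (@norm_hausdorff _ _)); apply; exact: cvg_cst.
move=> r s t r0 rs st tT; apply/funext => a /=.
have s0 := le_trans r0 rs; have sT := le_trans st tT; have rt := le_trans rs st.
apply/eqP; rewrite -subr_eq0 -normr_le0.
have dist0 (u : nat -> V) l :
    u n @[n --> \oo] --> l -> `|l - u n| @[n --> \oo] --> (0 : R).
  move=> ul; have h := cvg_norm (cvgB (cvg_cst l) ul).
  by rewrite subrr normr0 in h; exact: h.
have d1 := dist0 _ _ (psiP s t (psi s r a) s0 st tT).
have d2 := cvgM (cvg_cst (2 : R)) (dist0 _ _ (psiP r s a r0 rs sT)).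
have d3 := geometric_cvg0 c k0 k1.
have d4 := dist0 _ _ (psiP r t a r0 rt tT).
have /(_ _ _ _ _ _) d0 := cvgD (cvgD (cvgD d1 (d2 _ _)) d3) d4.
rewrite mulr0 !addr0 in d0.
rewrite -(cvg_lim _ d0) //; apply: limr_ge; first by apply/cvg_ex; exists 0.
apply: nearW => n.
have h1 := U_lip n s t (psi s r a) (U n s r a) s0 st tT.
have h2 := U_glue n r s t a r0 rs st tT.
have h3 := norm_triangle3 (psi t s (psi s r a)) (U n t s (psi s r a))
  (U n t s (U n s r a)) (psi t r a).
have h4 := ler_distD (U n t r a) (U n t s (U n s r a)) (psi t r a).
have h5 := distrC (psi t r a) (U n t r a).
rewrite !fctE /=; lra.
Qed.

End Limits.

(** * Uniqueness *)

(** A telescoping sum over the partition: the flow property lets one interval at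
    a time be exchanged, and the Lipschitz constant of [F] transports the error
    to the final time. *)
Lemma flow_unique_bound (R : realType) (V : normedModType R) (T c k : R)
    (w : R -> R -> R) (F G : R -> R -> V -> V) x l a :
  0 <= k -> 0 <= x -> path <=%R x l -> last x l <= T ->
  flow T F -> flow T G ->
  (forall s t a b, 0 <= s -> s <= t -> t <= T ->
     `|F t s a - F t s b| <= k * `|a - b|) ->
  (forall s t a, 0 <= s -> s <= t -> t <= T ->
     `|F t s a - G t s a| <= c * w s t) ->
  `|F (last x l) x a - G (last x l) x a| <= k * c * path_sum w x l.
Proof.
move=> k0 x0 pl lT [_ F_id F_flow] [_ G_id G_flow] F_lip FG.
elim: l x a x0 pl lT => [|y l IH] x a x0 /=.
  by move=> _ xT; rewrite F_id // G_id // subrr normr0 mulr0.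
move=> /andP[xy pl] lT; have yl := path_le_last pl.
have y0 := le_trans x0 xy; have yT := le_trans yl lT.
rewrite -(F_flow x y) // -(G_flow x y) //=.
apply: le_trans (ler_distD (F (last y l) y (G y x a)) _ _) _.
rewrite mulrDr lerD ?IH // -mulrA.
by apply: le_trans (F_lip _ _ _ _ y0 yl lT) _; rewrite ler_wpM2l ?FG.
Qed.

Lemma flow_unique (R : realType) (V : normedModType R) (T kappa c k : R)
    (w : R -> R -> R) (F G : R -> R -> V -> V) s t :
  0 <= kappa -> kappa < 1 -> halving T kappa w -> 0 <= k -> 0 <= c ->
  flow T F -> flow T G ->
  (forall s t a b, 0 <= s -> s <= t -> t <= T ->
     `|F t s a - F t s b| <= k * `|a - b|) ->
  (forall s t a, 0 <= s -> s <= t -> t <= T ->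
     `|F t s a - G t s a| <= c * w s t) ->
  0 <= s -> s <= t -> t <= T -> F t s = G t s.
Proof.
move=> kappa0 kappa1 w_halving k0 c0 F_flow G_flow F_lip FG s0 st tT.
apply/funext => a; apply/eqP; rewrite -subr_eq0 -normr_le0.
have [mid midP] := halving_midpoint w_halving.
apply: (@geometric_le0 _ _ (k * c * w s t) kappa kappa0 kappa1) => n.
have [pl el sl] := iter_bisect kappa0 midP n s0 st tT.
have lT : last s (iter n (bisect mid s) [:: t]) <= T by rewrite el.
have := flow_unique_bound a k0 s0 pl lT F_flow G_flow F_lip FG.
rewrite el => /le_trans; apply.
by rewrite -[leRHS]mulrA [w s t * _]mulrC ler_wpM2l ?mulr_ge0.
Qed.

(** * Controls, remainders and the 4-points control *)

Section ControlTheory.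
Context {R : realType}.
Variables (T : R) (omega : R -> R -> R).
Hypothesis omega_control : control T omega.

Lemma control_ge0 s t : 0 <= s -> s <= t -> t <= T -> 0 <= omega s t.
Proof. by have [h _ _ _] := omega_control; exact: h. Qed.

Lemma control_mono u s t v :
  0 <= u -> u <= s -> s <= t -> t <= v -> v <= T -> omega s t <= omega u v.
Proof.
move=> u0 us st tv vT; have [pos super _ _] := omega_control.
have s0 := le_trans u0 us; have t0 := le_trans s0 st; have tT := le_trans tv vT.
have h1 := super u s v u0 us (le_trans st tv) vT.
have h2 := super s t v s0 st tv vT.
have h3 := pos u s u0 us (le_trans st tT).
have h4 := pos t v t0 tv vT.
lra.
Qed.

Lemma control_small eps : 0 < T -> 0 < eps ->
  exists2 T0, 0 < T0 <= T & omega 0 T0 <= eps.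
Proof.
move=> T0 eps0; have [_ _ [e e0 /subspace_continuousP cont] diag] := omega_control.
have /= := cont (0, 0); rewrite subrr => /(_ (And4 (lexx 0) (lexx 0) (ltW T0) e0)).
move=> /cvgrPdist_le /(_ _ eps0); rewrite /from_subspace /= diag ?(ltW T0) //.
rewrite near_withinE => /nbhs_ballP[d /= d0 hd].
pose t := Num.min (Num.min T (e / 2)) (d / 2).
have t0 : 0 < t by rewrite !lt_min T0 !divr_gt0.
have tT : t <= T by rewrite !ge_min lexx.
have te : t <= e / 2 by rewrite !ge_min lexx orbT.
have td : t <= d / 2 by rewrite !ge_min lexx orbT.
exists t; first by rewrite t0.
have inball : ball ((0, 0) : R * R) d (0, t).
  split; first exact: ballxx.
  by rewrite -ball_normE /= sub0r normrN gtr0_norm //; lra.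
have := hd (0, t) inball; rewrite /= sub0r normrN => h.
apply: le_trans (ler_norm _) (h _); split=> //; first exact: ltW.
by rewrite subr0; lra.
Qed.

Lemma control_continuous : exists2 e, 0 < e & forall x y,
  0 <= x -> x <= y -> y <= T -> y - x < e -> {within `[x, y], continuous omega x}.
Proof.
have [_ _ [e e0 /subspace_continuousP cont] _] := omega_control.
exists e => // x y x0 xy yT yxe; apply/subspace_continuousP => z /=.
rewrite in_itv /= => /andP[xz zy].
have := cont (x, z); rewrite /= => /(_ _)/cvgrPdist_lt h.
apply/cvgrPdist_lt => eps eps0.
have {}h := h (And4 x0 xz (le_trans zy yT) (le_lt_trans (lerB zy (lexx x)) yxe)) _ eps0.
move: h; rewrite !near_withinE => /nbhs_ballP[d /= d0 hd].
apply/nbhs_ballP; exists d => //= u zu; rewrite in_itv /= => /andP[xu uy].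
apply: (hd (x, u)); first by split=> //=; exact: ballxx.
by split=> //=; [exact: le_trans yT | lra].
Qed.

End ControlTheory.

Lemma remainder_small (R : realType) (tau0 : R) (varpi : R -> R) (eps : R) :
  remainder tau0 varpi -> 0 <= tau0 -> 0 < eps ->
  exists2 d, 0 < d & forall tau, 0 <= tau -> tau <= tau0 -> tau <= d ->
    varpi tau <= eps.
Proof.
move=> [/subspace_continuousP cont _ _ _ v0] h0 eps0.
have := cont 0; rewrite /= in_itv /= lexx h0 => /(_ isT).
move=> /cvgrPdist_le /(_ _ eps0); rewrite /from_subspace /= v0.
rewrite near_withinE => /nbhs_ballP[d /= d0 hd].
exists (d / 2); first by rewrite divr_gt0.
move=> tau tau_ge0 tau_le taud.
have inball : ball (0 : R) d tau.
  by rewrite -ball_normE /= sub0r normrN ger0_norm //; lra.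
have := hd tau inball; rewrite /= in_itv /= tau_ge0 tau_le sub0r normrN.
by move=> /(_ isT); apply: le_trans; exact: ler_norm.
Qed.

Lemma remainder_le (R : realType) (tau0 : R) (varpi : R -> R) x y :
  remainder tau0 varpi -> 0 <= x -> x <= y -> y <= tau0 -> varpi x <= varpi y.
Proof.
move=> [_ homo _ _ _] x0; rewrite le_eqVlt => /predU1P[->//|xy] yt.
apply/ltW/homo => //; rewrite in_itv /=; apply/andP; split=> //.
  by rewrite (le_trans _ yt) ?ltW.
by rewrite (le_trans x0) ?ltW.
Qed.

Lemma modulus_small (R : realType) (delta : R -> R) (eps : R) :
  modulus delta -> 0 < eps -> exists2 d, 0 < d & delta d <= eps.
Proof.
move=> [_ _ dlim] eps0.
have : \forall x \near 0^'+, 0 < x /\ delta x <= eps.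
  near=> x; split; first by near: x; exact: nbhs_right_gt.
  apply: le_trans (ler_norm _) _; rewrite -[delta x]subr0 distrC; near: x.
  by move/cvgrPdist_le : dlim; apply.
by move=> /filter_ex[d []]; exists d.
Unshelve. all: by end_near. Qed.

(** The midpoint m of [x,y] solves omega_{x,m} = omega_{x,y} / 2.  Only
    horizons shorter than the width e of the strip on which omega is continuous
    are considered, so that the intermediate value theorem applies to every
    subinterval. *)
Lemma control_halving (R : realType) (T : R) (omega : R -> R -> R) (varpi : R -> R) :
  control T omega -> remainder (omega 0 T) varpi ->
  exists kappa e, [/\ 0 < kappa, kappa < 1, 0 < e &
    forall T1, T1 <= T -> T1 < e ->
      halving T1 kappa (fun s t => varpi (omega s t))].
Proof.
move=> wc rv; have [e e0 cont] := control_continuous wc.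
have [_ _ vpos [kappa [k0 k1 vhalf]] v0] := rv.
exists kappa, e; split=> // T1 T1T T1e.
have range s t : 0 <= s -> s <= t -> t <= T1 -> 0 <= omega s t <= omega 0 T.
  move=> s0 st tT1; have tT := le_trans tT1 T1T.
  by rewrite (control_ge0 wc) //= (control_mono wc).
have vhalf0 tau : 0 <= tau -> tau <= omega 0 T ->
    varpi (tau / 2) <= kappa / 2 * varpi tau.
  rewrite le_eqVlt => /predU1P[<- _|t0 tw]; first by rewrite mul0r v0 mulr0.
  by have := vhalf tau t0 tw; lra.
split.
- by move=> s t s0 st tT1; have /andP[? ?] := range s t s0 st tT1; exact: vpos.
- move=> u s t v u0 us st tv vT1.
  have /andP[w0 _] := range s t (le_trans u0 us) st (le_trans tv vT1).
  have /andP[_ w1] := range u v u0 (le_trans us (le_trans st tv)) vT1.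
  by apply: (remainder_le rv) => //; apply: (control_mono wc) => //; exact: le_trans T1T.
- move=> x y x0 xy yT1; have yT := le_trans yT1 T1T.
  have /andP[w0 w1] := range x y x0 xy yT1.
  have xT := le_trans xy yT.
  have [_ super _ /(_ x x0 xT) diag] := wc.
  have ivt : Num.min (omega x x) (omega x y) <= omega x y / 2
      <= Num.max (omega x x) (omega x y).
    by rewrite diag min_l // max_r //; lra.
  have yxe : y - x < e by lra.
  have [m] := IVT xy (cont x y x0 xy yT yxe) ivt.
  rewrite in_itv /= => /andP[xm my] wm.
  have wm2 := super x m y x0 xm my yT.
  have m0 := le_trans x0 xm.
  exists m; split=> //.
    by rewrite wm; exact: vhalf0.
  apply: le_trans (vhalf0 _ w0 w1).
  apply: (remainder_le rv); first exact: (control_ge0 wc).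
    by lra.
  by lra.
Qed.

(** With the maxima replaced by upper bounds, compatibility of [fhat] needs to be
    invoked only at the argument r, and not at distances between trajectories. *)
Lemma four_points_le (R : realType) (V : normedModType R) (f : V -> V)
    (fhat : R -> R) (fdag r B e d : R) (a1 a2 b1 b2 : V) :
  four_points_control f fhat fdag -> fhat r <= B -> fdag <= d ->
  `|a1 - a2| <= r -> `|b1 - b2| <= r -> `|a1 - b1| <= e -> `|a2 - b2| <= e ->
  `|(f a1 - f b1) - (f a2 - f b2)| <= B * e + d * `|(a1 - b1) - (a2 - b2)|.
Proof.
move=> [_ f_mono f_ge0 _ f4] rB fd a_r b_r e1 e2.
have := f4 a1 a2 b1 b2; rewrite !sub_regroup; move/le_trans; apply.
have m0 : 0 <= Num.max `|a1 - a2| `|b1 - b2| by rewrite le_max normr_ge0.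
apply: lerD; last by rewrite ler_wpM2r.
apply: ler_pM; rewrite ?f_ge0 ?le_max ?normr_ge0 // ?ge_max ?e1 ?e2 //.
by apply: le_trans rB; apply: f_mono => //; rewrite ge_max a_r b_r.
Qed.

(** * The flow in the galaxy of a stable almost flow *)

Theorem corollary1 (R : realType) (V : completeNormedModType R) (T : R)
    (omega : R -> R -> R) (varpi : R -> R) (phi : R -> R -> V -> V)
    (T_gt0 : 0 < T)
    (omega_control : control T omega)
    (varpi_remainder : remainder (omega 0 T) varpi)
    (phi_stable : stable_almost_flow T omega varpi phi) :
  exists T0 : R, [/\ 0 < T0, T0 <= T &
    forall T1 : R, 0 < T1 -> T1 <= T0 ->
    exists psi : R -> R -> V -> V,
      [/\ lipschitz_flow T1 psi,
          same_galaxy T1 omega varpi phi psi,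
          forall chi : R -> R -> V -> V,
            lipschitz_flow T1 chi -> same_galaxy T1 omega varpi phi chi ->
            forall s t : R, 0 <= s -> s <= t -> t <= T1 -> chi t s = psi t s
        & exists2 L : R, 0 <= L &
            forall s t : R, 0 <= s -> s <= t -> t <= T1 ->
              (lipnorm (psi t s \- phi t s)
                 <= (L * varpi (omega s t))%:E)%E]].
Proof.
have [kappa [e [k0 k1 e0 halv]]] := control_halving omega_control varpi_remainder.
have [_ [delta [M [C [phihat [phidag [delta_mod M0 C0 compat main]]]]]]] := phi_stable.
have [hat_mono [phicirc circ0 hat_circ]] := compat.
(* q lies strictly between kappa and 1, and eta is small enough for
   kappa (1 + 2 eta)^2 <= q.  The constants L, P and K depend only on kappa, M, C
   and phicirc; the horizon is chosen after them. *)
pose eta := (1 - kappa) / 16; pose q := (1 + kappa) / 2.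
have eta0 : 0 < eta by rewrite /eta; lra.
have eta16 : eta <= 1 / 16 by rewrite /eta; lra.
have q1 : 0 < 1 - q by rewrite /q; lra.
have kq : kappa * (1 + 2 * eta) ^+ 2 <= q.
  have h : (1 + 2 * eta) ^+ 2 <= 1 + 8 * eta.
    by have := mulr_ge0 (ltW eta0) (ltW eta0); have := ler_wpM2l (ltW eta0) eta16; lra.
  apply: le_trans (ler_wpM2l (ltW k0) h) _.
  have : 0 <= (1 - kappa) * (1 - kappa) by rewrite mulr_ge0 // subr_ge0 ltW.
  by rewrite /eta /q; lra.
pose L := 2 * M / (1 - q).
have L0 : 0 <= L by rewrite divr_ge0 ?mulr_ge0 // ltW.
(* The points compared by the 4-points control are at distance at most
   (1 + eta) L w, whence the argument 2 L. *)
pose P := phicirc (2 * L).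
have P0 : 0 <= P by apply: circ0; rewrite mulr_ge0.
pose K := (4 * P + 3 * C) / (1 - q).
have K0 : 0 <= K by apply: divr_ge0; [rewrite addr_ge0 ?mulr_ge0 | exact: ltW].
have L_eq : q * L + 2 * M <= L.
  by rewrite le_eqVlt; apply/orP; left; apply/eqP; rewrite /L; field; rewrite gt_eqF.
have K_eq : q * K + (4 * P + 3 * C) <= K.
  by rewrite le_eqVlt; apply/orP; left; apply/eqP; rewrite /K; field; rewrite gt_eqF.
have om_pos := control_ge0 omega_control; have om_mono := control_mono omega_control.
have om0T : 0 <= omega 0 T by apply: om_pos => //; exact: ltW.
have eps0 : 0 < eta / (K + 1) by rewrite divr_gt0 // ltr_wpDl.
(* A bound eta / (K + 1) on w yields K w <= eta also when K = 0. *)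
have [d d0 small] := remainder_small varpi_remainder om0T eps0.
have [t1 /andP[t1_gt0 t1T] om_t1] := control_small omega_control T_gt0 d0.
have [t2 t2_gt0 delta_t2] := modulus_small delta_mod eta0.
exists (Num.min t1 (Num.min t2 (e / 2))); split.
- by rewrite !lt_min t1_gt0 t2_gt0 divr_gt0.
- by rewrite ge_min t1T.
move=> T1 T1_gt0; rewrite !le_min => /and3P[T1t1 T1t2 T1e].
have T1T := le_trans T1t1 t1T; have T10 := ltW T1_gt0.
pose w s t := varpi (omega s t).
have w_halving : halving T1 kappa w by apply: halv => //; lra.
have w_ge0 := halving_ge0 w_halving.
have deltaT1 : delta T1 <= eta.
  by have [_ dm _] := delta_mod; apply: le_trans (dm _ _ T10 T1t2) delta_t2.
have Kw : K * w 0 T1 <= eta.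
  have wT1 : w 0 T1 <= eta / (K + 1).
    apply: small; [exact: om_pos|exact: om_mono|].
    by apply: le_trans om_t1; exact: om_mono.
  have := ler_wpM2l (addr_ge0 K0 ler01) wT1.
  by rewrite mulrCA divff ?gt_eqF ?ltr_wpDl //; have := w_ge0 _ _ (lexx 0) T10 (lexx T1); lra.
have est r s t := main T1 T1_gt0 T1T r s t.
have phi_id t : 0 <= t -> t <= T1 -> phi t t = id.
  by move=> t0 tT; have [[-> _ _ _] _ _] := est t t t t0 (lexx t) (lexx t) tT.
have phi_lip s t : 0 <= s -> s <= t -> t <= T1 -> forall a b,
    `|phi t s a - phi t s b| <= (1 + eta) * `|a - b|.
  move=> s0 st tT a b; have [[_ _ /lipnorm_leP[_ h] _] _ _] := est s s t s0 (lexx s) st tT.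
  by apply: le_trans (h a b) _; rewrite ler_wpM2r // lerD2l.
have phi_defect r s t : 0 <= r -> r <= s -> s <= t -> t <= T1 -> forall a,
    `|phi t s (phi s r a) - phi t r a| <= M * w r t.
  by move=> r0 rs st tT; have [[_ _ _ /supnorm_leP h] _ _] := est r s t r0 rs st tT.
have phi_defect_lip r s t : 0 <= r -> r <= s -> s <= t -> t <= T1 -> forall a b,
    `|(phi t s (phi s r a) - phi t s (phi s r b)) - (phi t r a - phi t r b)|
      <= C * w r t * `|a - b|.
  move=> r0 rs st tT a b; have [_ _ /lipnorm_leP[_ h]] := est r s t r0 rs st tT.
  by have := h a b; rewrite /flow_defect /= sub_swap.
have four u s t v : 0 <= u -> u <= s -> s <= t -> t <= v -> v <= T1 ->
    forall a b c d e, `|a - b| <= 2 * L * w u v -> `|c - d| <= 2 * L * w u v ->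
    `|a - c| <= e -> `|b - d| <= e ->
    `|(phi t s a - phi t s c) - (phi t s b - phi t s d)| <=
      P * w u v * e + (1 + eta) * `|(a - c) - (b - d)|.
  move=> u0 us st tv vT a b c d' e' ab cd ac bd.
  have s0 := le_trans u0 us; have tT := le_trans tv vT.
  have uv := le_trans us (le_trans st tv).
  have [_ [h4 dag] _] := est s s t s0 (lexx s) st tT.
  have W0 : 0 <= 2 * L * w u v by apply: mulr_ge0; [exact: mulr_ge0 | exact: w_ge0].
  apply: (four_points_le (r := 2 * L * w u v) h4) => //; last by rewrite (le_trans dag) // lerD2l.
  apply: le_trans (hat_mono u s t v u0 us st tv (le_trans vT T1T) _ W0) _.
  by apply: hat_circ => //; [exact: le_trans T1T|rewrite mulr_ge0].
have [U UP] := approximate_flows (ltW k0) k1 (ltW eta0) M0 C0 L0 P0 K0 eta16 kq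
  L_eq K_eq w_halving Kw phi_id phi_lip phi_defect phi_defect_lip four T10.
pose c := 2 * M * w 0 T1.
have cE n : 2 * M * (kappa ^+ n * w 0 T1) = c * kappa ^+ n.
  by rewrite /c -mulrA [kappa ^+ n * _]mulrC mulrA mulrA.
have [psi [U_psi psi_id psi_flow]] : exists psi : R -> R -> V -> V,
  [/\ forall s t a, 0 <= s -> s <= t -> t <= T1 ->
        U n t s a @[n --> \oo] --> psi t s a,
      forall t, 0 <= t -> t <= T1 -> psi t t = id
    & forall r s t, 0 <= r -> r <= s -> s <= t -> t <= T1 ->
        psi t s \o psi s r = psi t r].
  apply: (@limit_flow R V T1 c kappa U (ltW k0) k1).
  - by move=> n; have [h _ _ _ _] := UP n.
  - by move=> n s t a b s0 st tT; have [_ _ _ _ /(_ s t a b s0 st tT)[]] := UP n.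
  - by move=> n s t a s0 st tT; rewrite -cE; have [_ h _ _ _] := UP n; exact: h.
  - by move=> n r s t a r0 rs st tT; rewrite -cE; have [_ _ h _ _] := UP n; exact: h.
have psi_close s t a : 0 <= s -> s <= t -> t <= T1 ->
    `|psi t s a - phi t s a| <= L * w s t.
  move=> s0 st tT.
  apply: cvg_norm_le (cvgB (U_psi s t a s0 st tT) (cvg_cst (phi t s a))) _ => n.
  by have [_ _ _ h _] := UP n; exact: h.
have psi_lip s t a b : 0 <= s -> s <= t -> t <= T1 ->
    `|psi t s a - psi t s b| <= 2 * `|a - b|.
  move=> s0 st tT.
  apply: cvg_norm_le (cvgB (U_psi s t a s0 st tT) (U_psi s t b s0 st tT)) _ => n.
  by have [_ _ _ _ /(_ s t a b s0 st tT)[]] := UP n.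
have psi_close_lip s t a b : 0 <= s -> s <= t -> t <= T1 ->
    `|(psi t s a - psi t s b) - (phi t s a - phi t s b)| <= K * w s t * `|a - b|.
  move=> s0 st tT.
  apply: cvg_norm_le (cvgB (cvgB (U_psi s t a s0 st tT) (U_psi s t b s0 st tT))
    (cvg_cst (phi t s a - phi t s b))) _ => n.
  by have [_ _ _ _ /(_ s t a b s0 st tT)[]] := UP n.
have psi_isflow : flow T1 psi.
  split=> // s t s0 st tT; apply: (@lipschitz_continuous _ _ _ 2) => a b.
  exact: psi_lip.
exists psi; split.
- split=> //; exists 2 => s t s0 st tT; apply/lipnorm_leP; split=> // a b.
  exact: psi_lip.
- exists L => s t s0 st tT; apply/supnorm_leP => a /=.
  by rewrite distrC; exact: psi_close.
- move=> chi [chi_flow [k chi_lip]] [c' chi_close] s t s0 st tT.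
  have [k_ge0 _] := (lipnorm_leP _ _).1 (chi_lip s t s0 st tT).
  (* The galaxy constant c' may be negative if w vanishes identically, hence
     its absolute value. *)
  apply: (@flow_unique R V T1 kappa (`|c'| + L) k w chi psi s t) => //.
  + exact: ltW.
  + by rewrite addr_ge0.
  + by move=> u v a b u0 uv vT; have [_] := (lipnorm_leP _ _).1 (chi_lip u v u0 uv vT).
  + move=> u v a u0 uv vT.
    apply: le_trans (ler_distD (phi v u a) _ _) _.
    rewrite mulrDl lerD //; last by rewrite distrC psi_close.
    have := (supnorm_leP _ _).1 (chi_close u v u0 uv vT) a.
    rewrite /= distrC => /le_trans; apply.
    by rewrite ler_wpM2r ?w_ge0 // ler_norm.
- exists K => // s t s0 st tT; apply/lipnorm_leP; split=> [|a b].
    by rewrite mulr_ge0 ?w_ge0.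
  by rewrite /= sub_swap psi_close_lip.
Qed.
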